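(* Let $G$ be a finite $5$-group of nilpotency class $5$. Then $\exp(G\wedge G)$ divides $\exp(G)$.
   Context: Conventions: ${}^g h = ghg^{-1}$, $[g,h]=ghg^{-1}h^{-1}$. The nonabelian tensor square $G\otimes G$ is generated by symbols $g\otimes h$ subject to $gg'\otimes h=({}^g g'\otimes {}^g h)(g\otimes h)$ and $g\otimes hh'=(g\otimes h)({}^h g\otimes {}^h h')$; the exterior square $G\wedge G$ is its quotient by the subgroup generated by all $x\otimes x$. *)

(* Defs.v *)
From mathcomp Require Import all_boot all_fingroup all_solvable.
Set Implicit Arguments.
Unset Strict Implicit.
Unset Printing Implicit Defensive.
Local Open Scope group_scope.

(* Nonabelian exterior square G /\ G of a (finite) group, given by its
   presentation, realised as words modulo the congruence generated by the
   free-group cancellation rules and the defining relations.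
   Convention of the paper: ^g h = g h g^-1. *)

Definition lconj (gT : finGroupType) (g h : gT) : gT := g * h * g^-1.

(* a letter (g, h, b) stands for g /\ h if b = false, (g /\ h)^-1 if b = true *)
Definition wletter (gT : finGroupType) := (gT * gT * bool)%type.
Definition wgen (gT : finGroupType) (g h : gT) : wletter gT := (g, h, false).
Definition winv_letter (gT : finGroupType) (a : wletter gT) : wletter gT :=
  (a.1.1, a.1.2, ~~ a.2).

Inductive wedge_eq (gT : finGroupType) : seq (wletter gT) -> seq (wletter gT) -> Prop :=
| we_refl w : wedge_eq w w
| we_sym w1 w2 : wedge_eq w1 w2 -> wedge_eq w2 w1
| we_trans w1 w2 w3 : wedge_eq w1 w2 -> wedge_eq w2 w3 -> wedge_eq w1 w3
| we_cat u1 u2 v1 v2 : wedge_eq u1 u2 -> wedge_eq v1 v2 ->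
    wedge_eq (u1 ++ v1) (u2 ++ v2)
| we_cancel a : wedge_eq [:: a; winv_letter a] [::]
| we_rel_l g g' h :
    wedge_eq [:: wgen (g * g') h] [:: wgen (lconj g g') (lconj g h); wgen g h]
| we_rel_r g h h' :
    wedge_eq [:: wgen g (h * h')] [:: wgen g h; wgen (lconj h g) (lconj h h')]
| we_diag x : wedge_eq [:: wgen x x] [::].

Definition wpow (gT : finGroupType) (w : seq (wletter gT)) (n : nat) :=
  flatten (nseq n w).

Definition wedge_exp_dvd (gT : finGroupType) (n : nat) : Prop :=
  forall w : seq (wletter gT), wedge_eq (wpow w n) [::].

(* Main.v *)
Require Import Defs.
From HB Require Import structures.
From mathcomp Require Import all_boot all_fingroup all_solvable.
From mathcomp Require Import pgroup nilpotent abelian.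
From mathcomp Require Import generic_quotient boolp zify.

(* Work directly in W = G /\ G, with its G-action and the crossed module map
   bd : W -> G, g /\ h |-> [g, h]. Let W_k ([wlc k] below) be the subgroup generated
   by the x /\ u with u in the (k-1)-st term of the lower central series. Then W_2 = W,
   W_7 = 1, and for g in L_j(G) and w in W_i the element D_g w = w^-1 ^g w is in W_(i+j).
   Let n = exp(G). Expanding x /\ y^n = 1 shows that the product of the ^(y^i) w over
   i < n is trivial, where w = x /\ y; collecting it gives
     1 = w^n (D_y w)^C(n,2) (D_y^2 w)^C(n,3) (D_y^3 w)^C(n,4) (D_y^4 w)^C(n,5) c
   for some product c of powers of commutators. As n is prime to 6, descending
   induction on k shows that W_3 has exponent dividing n, and then
   w^n (D_y^4 w)^C(n,5) = 1. Since x /\ y x^k = x /\ y, the element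
   (D_(y x^k)^4 w)^C(n,5) does not depend on k; it is a polynomial of degree 4 in k with
   values in a central group of exponent 5, so its leading coefficient
   (D_x^4 w)^C(n,5) vanishes. Exchanging x and y gives (x /\ y)^n = 1, and the same
   collection formula, with g = bd z acting by conjugation by z, shows that
   (w z)^n = 1 as soon as w^n = z^n = 1. *)

Set Implicit Arguments.
Unset Strict Implicit.
Unset Printing Implicit Defensive.

Import GroupScope.
Local Open Scope quotient_scope.
Local Open Scope group_scope.

(** * The group of words modulo the defining congruence *)

Section WedgeGroup.

Variable gT : finGroupType.
Implicit Types (g h k x y : gT) (a : wletter gT) (u v : seq (wletter gT)).

Definition wedge_eqb : rel (seq (wletter gT)) := fun u v => `[< wedge_eq u v >].

Lemma wedge_eqb_refl : reflexive wedge_eqb.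
Proof. by move=> u; apply/asboolP; apply: we_refl. Qed.

Lemma wedge_eqb_sym : symmetric wedge_eqb.
Proof. by move=> u v; apply/asboolP/asboolP => /we_sym. Qed.

Lemma wedge_eqb_trans : transitive wedge_eqb.
Proof.
by move=> v u w /asboolP uv /asboolP vw; apply/asboolP; apply: we_trans uv vw.
Qed.

Canonical wedge_equiv :=
  EquivRel wedge_eqb wedge_eqb_refl wedge_eqb_sym wedge_eqb_trans.

Definition wedge := {eq_quot wedge_equiv}.
HB.instance Definition _ := Choice.on wedge.

Definition wcls u : wedge := \pi u.

Lemma wclsP u v : wcls u = wcls v <-> wedge_eq u v.
Proof.
split=> [/eqP | uv]; first by rewrite eqmodE => /asboolP.
by apply/eqP; rewrite eqmodE; apply/asboolP.
Qed.

Lemma wcls_repr (w : wedge) : wcls (repr w) = w.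
Proof. exact: reprK. Qed.

Lemma wedge_eq_repr u : wedge_eq (repr (wcls u)) u.
Proof. by apply/wclsP; rewrite wcls_repr. Qed.

Definition winv u : seq (wletter gT) := rev (map (@winv_letter gT) u).

Lemma winv_letterK : involutive (@winv_letter gT).
Proof. by case=> [[g h] b]; rewrite /winv_letter /= negbK. Qed.

Lemma winvK : involutive winv.
Proof. by move=> u; rewrite /winv map_rev revK mapK //; apply: winv_letterK. Qed.

Lemma wedge_eq_catV u : wedge_eq (u ++ winv u) [::].
Proof.
elim: u => [|a u IHu]; first exact: we_refl.
have -> : (a :: u) ++ winv (a :: u) = [:: a] ++ ((u ++ winv u) ++ [:: winv_letter a]).
  by rewrite /winv /= rev_cons -cats1 catA.
apply: we_trans (we_cancel a); rewrite -[[:: a; _]]cat1s.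
apply: we_cat (we_refl _) _; rewrite -[X in wedge_eq _ X]cat0s.
exact: we_cat IHu (we_refl _).
Qed.

Lemma wedge_eq_Vcat u : wedge_eq (winv u ++ u) [::].
Proof. by rewrite -{2}[u]winvK; apply: wedge_eq_catV. Qed.

(** The congruence has no rule for inversion; uniqueness of inverses replaces it, through the word
    [winv u ++ v ++ winv v]. *)
Lemma wedge_eq_winv u v : wedge_eq u v -> wedge_eq (winv u) (winv v).
Proof.
move=> uv; apply: (we_trans (w2 := winv u ++ (v ++ winv v))).
  rewrite -{1}[winv u]cats0; apply: we_cat (we_refl _) _.
  by apply: we_sym; apply: wedge_eq_catV.
rewrite catA -[X in wedge_eq _ X]cat0s; apply: we_cat (we_refl _).
apply: we_trans (wedge_eq_Vcat u).
by apply: we_cat (we_refl _) _; apply: we_sym.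
Qed.

Definition wedge_one := wcls [::].
Definition wedge_mul (w z : wedge) := wcls (repr w ++ repr z).
Definition wedge_inv (w : wedge) := wcls (winv (repr w)).

Lemma wedge_mulE u v : wedge_mul (wcls u) (wcls v) = wcls (u ++ v).
Proof. by apply/wclsP; apply: we_cat; apply: wedge_eq_repr. Qed.

Lemma wedge_invE u : wedge_inv (wcls u) = wcls (winv u).
Proof. by apply/wclsP; apply: wedge_eq_winv; apply: wedge_eq_repr. Qed.

Lemma wedge_mulA : associative wedge_mul.
Proof.
move=> u v w; rewrite -[u]wcls_repr -[v]wcls_repr -[w]wcls_repr.
by rewrite !wedge_mulE catA.
Qed.

Lemma wedge_mul1 : left_id wedge_one wedge_mul.
Proof. by move=> u; rewrite -[u]wcls_repr wedge_mulE. Qed.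

Lemma wedge_muln1 : right_id wedge_one wedge_mul.
Proof. by move=> u; rewrite -[u]wcls_repr wedge_mulE cats0. Qed.

Lemma wedge_mulV : left_inverse wedge_one wedge_inv wedge_mul.
Proof.
move=> u; rewrite -[u]wcls_repr wedge_invE wedge_mulE.
by apply/wclsP; apply: wedge_eq_Vcat.
Qed.

Lemma wedge_mulnV : right_inverse wedge_one wedge_inv wedge_mul.
Proof.
move=> u; rewrite -[u]wcls_repr wedge_invE wedge_mulE.
by apply/wclsP; apply: wedge_eq_catV.
Qed.

HB.instance Definition _ := isGroup.Build wedge
  wedge_mulA wedge_mul1 wedge_muln1 wedge_mulV wedge_mulnV.

Lemma wcls_cat u v : wcls (u ++ v) = wcls u * wcls v.
Proof. by rewrite -wedge_mulE. Qed.

Lemma wcls_winv u : wcls (winv u) = (wcls u)^-1.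
Proof. by rewrite -wedge_invE. Qed.

Lemma wcls_wpow u n : wcls (wpow u n) = wcls u ^+ n.
Proof. by elim: n => // n IHn; rewrite expgS -IHn -wcls_cat. Qed.

Definition wg g h : wedge := wcls [:: wgen g h].

Lemma wedge_ind (P : wedge -> Prop) : P 1 ->
  (forall g h w, P w -> P (wg g h * w)) ->
  (forall g h w, P w -> P ((wg g h)^-1 * w)) -> forall w, P w.
Proof.
move=> P1 Pg PV w; rewrite -[w]wcls_repr; elim: (repr w) => // [[[g h] b] u].
move=> IHu; rewrite -cat1s wcls_cat; case: b; last exact: Pg.
by have -> : [:: (g, h, true)] = winv [:: wgen g h] by []; rewrite wcls_winv; apply: PV.
Qed.

(** * The action of G on G /\ G by conjugation *)

Lemma lconjM k g h : lconj k (g * h) = lconj k g * lconj k h.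
Proof. by rewrite /lconj !mulgA mulgKV. Qed.

Lemma lconjJ k g h : lconj k (lconj g h) = lconj (lconj k g) (lconj k h).
Proof. by rewrite /lconj !invMg invgK !mulgA !mulgKV. Qed.

Definition wact_letter k a : wletter gT := (lconj k a.1.1, lconj k a.1.2, a.2).

Lemma wedge_eq_wact k u v :
  wedge_eq u v -> wedge_eq (map (wact_letter k) u) (map (wact_letter k) v).
Proof.
elim=> {u v} [u|u v _ IH|u v w _ IH1 _ IH2|u1 u2 v1 v2 _ IHu _ IHv|a|g g' h|g h h'|x].
- exact: we_refl.
- exact: we_sym.
- exact: we_trans IH1 IH2.
- by rewrite !map_cat; apply: we_cat.
- exact: we_cancel.
- by rewrite /= /wact_letter /= lconjM (lconjJ k g g') (lconjJ k g h); apply: we_rel_l.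
- by rewrite /= /wact_letter /= lconjM (lconjJ k h g) (lconjJ k h h'); apply: we_rel_r.
- exact: we_diag.
Qed.

Definition wact k (w : wedge) : wedge := wcls (map (wact_letter k) (repr w)).

Lemma wact_wcls k u : wact k (wcls u) = wcls (map (wact_letter k) u).
Proof. by apply/wclsP; apply: wedge_eq_wact; apply: wedge_eq_repr. Qed.

Lemma wactM k : {morph wact k : w z / w * z}.
Proof.
move=> w z; rewrite -[w]wcls_repr -[z]wcls_repr -wcls_cat !wact_wcls.
by rewrite map_cat wcls_cat.
Qed.

Lemma wact1g k : wact k 1 = 1.
Proof. exact: wact_wcls. Qed.

Lemma wactV k : {morph wact k : w / w^-1}.
Proof. by move=> w; apply: (mulgI (wact k w)); rewrite -wactM !mulgV wact1g. Qed.

Lemma wact_wg k g h : wact k (wg g h) = wg (lconj k g) (lconj k h).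
Proof. exact: wact_wcls. Qed.

Lemma wact_comp k g w : wact k (wact g w) = wact (k * g) w.
Proof.
rewrite -[w]wcls_repr !wact_wcls -map_comp; congr wcls; apply: eq_map.
by case=> [[x y] b]; rewrite /wact_letter /lconj /= !invMg !mulgA.
Qed.

Lemma wact_one w : wact 1 w = w.
Proof.
rewrite -[w]wcls_repr wact_wcls -[X in _ = wcls X]map_id; congr wcls.
by apply: eq_map => [[[x y] b]]; rewrite /wact_letter /lconj /= invg1 !mulg1 !mul1g.
Qed.

(** * The commutator map and the crossed module identities *)

Definition lcomm g h := g * h * g^-1 * h^-1.

Definition bd_letter a := if a.2 then (lcomm a.1.1 a.1.2)^-1 else lcomm a.1.1 a.1.2.

Definition bd_word u := \prod_(a <- u) bd_letter a.

Lemma wedge_eq_bd u v : wedge_eq u v -> bd_word u = bd_word v.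
Proof.
rewrite /bd_word.
elim=> {u v} // [u v w _ -> _ ->|u1 u2 v1 v2 _ IHu _ IHv|[[x y] b]|g g' h|g h h'|x] //.
- by rewrite !big_cat /= IHu IHv.
- by rewrite !big_cons big_nil /bd_letter /= mulg1; case: b; rewrite /= ?mulgV ?mulVg.
- rewrite !big_cons big_nil /bd_letter /lcomm /lconj /= !mulg1.
  by rewrite !invMg !invgK !mulgA !mulgKV.
- rewrite !big_cons big_nil /bd_letter /lcomm /lconj /= !mulg1.
  by rewrite !invMg !invgK !mulgA !mulgKV.
- by rewrite big_cons big_nil /bd_letter /lcomm /= mulgK mulgV mulg1.
Qed.

Definition bd (w : wedge) : gT := bd_word (repr w).

Lemma bd_wcls u : bd (wcls u) = bd_word u.
Proof. by apply: wedge_eq_bd; apply: wedge_eq_repr. Qed.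

Lemma bdM : {morph bd : w z / w * z}.
Proof.
move=> w z; rewrite -[w]wcls_repr -[z]wcls_repr -wcls_cat !bd_wcls.
by rewrite /bd_word big_cat.
Qed.

Lemma bd1 : bd 1 = 1.
Proof. by rewrite [LHS]bd_wcls /bd_word big_nil. Qed.

Lemma bdV : {morph bd : w / w^-1}.
Proof. by move=> w; apply: (mulgI (bd w)); rewrite -bdM !mulgV bd1. Qed.

Lemma bd_wg g h : bd (wg g h) = lcomm g h.
Proof. by rewrite bd_wcls /bd_word big_seq1. Qed.

Lemma wgMl g g' h : wg (g * g') h = wact g (wg g' h) * wg g h.
Proof. by rewrite wact_wg -wcls_cat; apply/wclsP; apply: we_rel_l. Qed.

Lemma wgMr g h h' : wg g (h * h') = wg g h * wact h (wg g h').
Proof. by rewrite wact_wg -wcls_cat; apply/wclsP; apply: we_rel_r. Qed.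

Lemma wgg x : wg x x = 1.
Proof. by apply/wclsP; apply: we_diag. Qed.

Lemma wg1 g : wg g 1 = 1.
Proof. by apply: (mulgI (wg g 1)); rewrite mulg1 -{3}(mulg1 1) wgMr wact_one. Qed.

Lemma wg1l h : wg 1 h = 1.
Proof. by apply: (mulgI (wg 1 h)); rewrite mulg1 -{3}(mulg1 1) wgMl wact_one. Qed.

Lemma wact_inj g : injective (wact g).
Proof.
by move=> w z /(congr1 (wact g^-1)); rewrite !wact_comp mulVg !wact_one.
Qed.

(** Expand (xy) /\ (xy) = 1: the terms x /\ x and y /\ y vanish, and what is left is the image under
    x of (y /\ x)(x /\ y). *)
Lemma wgV x y : wg x y = (wg y x)^-1.
Proof.
apply: (mulgI (wg y x)); rewrite mulgV; apply: (@wact_inj x); rewrite wact1g wactM.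
by rewrite -(wgg (x * y)) wgMl !wgMr !wgg wact1g mulg1 mul1g.
Qed.

(* Expand [gg' /\ hh'] in the two possible orders. *)
Lemma peiffer_gen g h g' h' :
  wact (g * h) (wg g' h') * wg g h = wg g h * wact (h * g) (wg g' h').
Proof.
have E1 : wg (g * g') (h * h') =
    wact g (wg g' h) * (wact (g * h) (wg g' h') * wg g h) * wact h (wg g h').
  by rewrite wgMl !wgMr wactM wact_comp !mulgA.
have E2 : wg (g * g') (h * h') =
    wact g (wg g' h) * (wg g h * wact (h * g) (wg g' h')) * wact h (wg g h').
  by rewrite wgMr !wgMl wactM wact_comp !mulgA.
by apply/(mulgI (wact g (wg g' h)))/(mulIg (wact h (wg g h'))); rewrite -E1.
Qed.

Lemma peiffer_wg g h z : wact (lcomm g h) z * wg g h = wg g h * z.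
Proof.
elim/wedge_ind: z => [|g' h' z IH|g' h' z IH].
- by rewrite wact1g mulg1 mul1g.
- rewrite wactM -mulgA IH !mulgA; congr (_ * _).
  (* Translating g' /\ h' by the inverse of hg turns the actions of gh and hg into those of [g, h]
     and 1. *)
  have := peiffer_gen g h (lconj (h * g)^-1 g') (lconj (h * g)^-1 h').
  by rewrite -wact_wg !wact_comp mulgV wact_one /lcomm invMg !mulgA.
- rewrite wactM -mulgA IH !mulgA; congr (_ * _).
  apply: (mulgI (wact (lcomm g h) (wg g' h'))).
  rewrite !mulgA -wactM mulgV wact1g mul1g.
  apply: (mulIg (wg g' h')); rewrite mulgKV.
  have := peiffer_gen g h (lconj (h * g)^-1 g') (lconj (h * g)^-1 h').
  by rewrite -wact_wg !wact_comp mulgV wact_one /lcomm invMg !mulgA => ->.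
Qed.

(** The Peiffer identity makes conjugation in G /\ G a case of the action of G, so one collection
    formula serves both x /\ y^n and (w z)^n. *)
Lemma peiffer w z : wact (bd w) z * w = w * z.
Proof.
elim/wedge_ind: w z => [|g h w IH|g h w IH] z.
- by rewrite bd1 wact_one mulg1 mul1g.
- by rewrite bdM bd_wg -wact_comp mulgA peiffer_wg -!mulgA IH.
- rewrite bdM bdV bd_wg -wact_comp; apply: (mulgI (wg g h)).
  rewrite -[in RHS]mulgA mulVKg [LHS]mulgA -peiffer_wg wact_comp mulgV wact_one.
  by rewrite -mulgA mulVKg IH.
Qed.

Lemma wact_bd w z : wact (bd w) z = w * z * w^-1.
Proof. by rewrite -(peiffer w z) mulgK. Qed.

(** Expand the left entry along [x, y] = x (^y x^-1). *)
Lemma wg_lcomm x y g : wg (lcomm x y) g = wg x y * wact g (wg x y)^-1.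
Proof.
have EV h : wg x^-1 h = wact x^-1 (wg x h)^-1.
  apply: (@wact_inj x); rewrite wact_comp mulgV wact_one.
  by apply: (mulIg (wg x h)); rewrite -wgMl mulgV wg1l mulVg.
have -> : lcomm x y = x * lconj y x^-1 by rewrite /lcomm /lconj !mulgA.
have Eg : g = lconj y (lconj y^-1 g) by rewrite /lconj invgK !mulgA mulgV mul1g mulgK.
rewrite wgMl {1}Eg -wact_wg EV !wact_comp.
have -> : x * y * x^-1 = lcomm x y * y by rewrite /lcomm mulgKV.
rewrite -wact_comp -bd_wg wact_bd !wactV.
(* Both sides expand x /\ gy, because gy = y (y^-1 g y). *)
have E : wg x y * wact y (wg x (lconj y^-1 g)) = wg x g * wact g (wg x y).
  by rewrite -!wgMr; congr wg; rewrite /lconj invgK !mulgA mulgV mul1g.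
rewrite -mulgA -mulgA; congr (_ * _).
by rewrite mulgA -invMg E invMg mulgKV.
Qed.

(** The generator case is [wg_lcomm] with the entries exchanged; it extends to products because, by
    the Peiffer identity, both sides obey the same product rule in [w]. *)
Lemma wg_bd g w : wg g (bd w) = wact g w * w^-1.
Proof.
have H1 x y : wg g (bd (wg x y)) = wact g (wg x y) * (wg x y)^-1.
  by rewrite bd_wg wgV wg_lcomm wactV invMg invgK.
have HM w1 w2 : wg g (bd w1) = wact g w1 * w1^-1 ->
    wg g (bd w2) = wact g w2 * w2^-1 ->
    wg g (bd (w1 * w2)) = wact g (w1 * w2) * (w1 * w2)^-1.
  by move=> E1 E2; rewrite bdM wgMr E1 E2 wact_bd wactM invMg !mulgA mulgKV.
have HV z : wg g (bd z) = wact g z * z^-1 -> wg g (bd z^-1) = wact g z^-1 * z^-1^-1.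
  have -> : wg g (bd z^-1) = wact (bd z^-1) (wg g (bd z))^-1.
    rewrite bdV; apply: (@wact_inj (bd z)); rewrite wact_comp mulgV wact_one.
    by apply: (mulgI (wg g (bd z))); rewrite -wgMr !mulgV wg1.
  by move=> ->; rewrite wact_bd invMg !invgK wactV mulKg.
elim/wedge_ind: w => [|x y w IH|x y w IH].
- by rewrite bd1 wg1 wact1g invg1 mulg1.
- exact: HM.
- exact: HM (HV _ (H1 x y)) IH.
Qed.

End WedgeGroup.

(** * The filtration of G /\ G by weight *)

Section WedgeFiltration.

Variable gT : finGroupType.
Implicit Types (g h x y : gT) (w z : wedge gT) (i j k : nat).

Local Notation L k := 'L_k([set: gT]).

(** The index is a weight: [g] counts 1 and [h] counts [k.-1], so that [bd] sends weight [k] into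
    [L k]. Since [L 0] and [L 1] are both G, weights 0, 1 and 2 all give the whole group. *)
Inductive wlc k : wedge gT -> Prop :=
| wlc1 : wlc k 1
| wlcM w z : wlc k w -> wlc k z -> wlc k (w * z)
| wlcV w : wlc k w -> wlc k w^-1
| wlc_gen g h : h \in L k.-1 -> wlc k (wg g h).

Lemma wlc2 w : wlc 2 w.
Proof.
have G g h : wlc 2 (wg g h) by apply: wlc_gen; rewrite lcn1 inE.
elim/wedge_ind: w => [|g h w|g h w]; first exact: wlc1.
  exact: wlcM.
by apply: wlcM; apply: wlcV.
Qed.

Lemma wlcS k w : wlc k.+1 w -> wlc k w.
Proof.
elim=> {w} [|w z _ Vw _ Vz|w _ Vw|g h Lh]; [exact: wlc1 | exact: wlcM | exact: wlcV | ].
by apply: wlc_gen; apply: subsetP Lh; apply: lcn_sub_leq; apply: leq_pred.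
Qed.

Lemma wlc_leq i k w : i <= k -> wlc k w -> wlc i w.
Proof. by move/subnK <-; elim: (k - i)%N => // m IHm /wlcS. Qed.

Lemma wlcX k w n : wlc k w -> wlc k (w ^+ n).
Proof. by move=> Vw; elim: n => [|n IHn]; rewrite ?expgS; [apply: wlc1 | apply: wlcM]. Qed.

Lemma lcn_lconj k g h : h \in L k -> lconj g h \in L k.
Proof.
move=> Lh; have -> : lconj g h = h ^ g^-1 by rewrite /lconj conjgE invgK mulgA.
by rewrite memJ_norm // (subsetP (lcn_norm k _)) ?inE.
Qed.

Lemma wlc_wact k g w : wlc k w -> wlc k (wact g w).
Proof.
elim=> {w} [|w z _ Vw _ Vz|w _ Vw|x y Ly].
- by rewrite wact1g; apply: wlc1.
- by rewrite wactM; apply: wlcM.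
- by rewrite wactV; apply: wlcV.
- by rewrite wact_wg; apply: wlc_gen; apply: lcn_lconj.
Qed.

Lemma wlc_bd k w : wlc k w -> bd w \in L k.
Proof.
elim=> {w} [|w z _ Vw _ Vz|w _ Vw|g h Lh].
- by rewrite bd1 group1.
- by rewrite bdM groupM.
- by rewrite bdV groupV.
- have -> : bd (wg g h) = [~ g^-1, h^-1].
    by rewrite bd_wg commgEl conjgE !invgK !mulgA.
  case: k Lh => [|k] Lh; first by rewrite inE.
  apply: (subsetP (lcnSnS k _)); rewrite commGC.
  by apply: mem_commg; rewrite ?inE // groupV.
Qed.

Lemma wlc_conj k w z : wlc k w -> wlc k (z * w * z^-1).
Proof. by rewrite -wact_bd; apply: wlc_wact. Qed.

(** Written additively, this is the operator g - 1 applied to [w]. *)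
Definition wactD g w := w^-1 * wact g w.

Lemma wact_wactD g w : wact g w = w * wactD g w.
Proof. by rewrite /wactD mulKVg. Qed.

Lemma wactD_bd z w : wactD (bd z) w = [~ w, z^-1].
Proof. by rewrite /wactD wact_bd commgEl conjgE invgK !mulgA. Qed.



(** By [wg_bd] the difference is the inverse of g /\ bd w^-1, whose right entry lies in [L i]. *)
Lemma wlc_wactD1 i g w : wlc i w -> wlc i.+1 (wactD g w).
Proof.
move=> Vw; have -> : wactD g w = (wg g (bd w^-1))^-1.
  by rewrite wg_bd wactV invMg !invgK.
by apply: wlcV; apply: wlc_gen; apply: wlc_bd; apply: wlcV.
Qed.

Lemma wlc_comm1 i w z : wlc i w -> wlc i.+1 [~ w, z].
Proof. by move=> Vw; rewrite -[z]invgK -wactD_bd; apply: wlc_wactD1. Qed.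

(** Quantifying over all weights [i] lets difference operators be composed. *)
Definition depth j g := forall i w, wlc i w -> wlc (i + j) (wactD g w).

(** Additively, gh - 1 = (g - 1) + (h - 1) + (g - 1)(h - 1). *)
Lemma wactD_mul g h w : wactD (g * h) w = wactD g w * wactD h w * wactD g (wactD h w).
Proof.
by rewrite -mulgA -(wact_wactD g (wactD h w)) /wactD -wact_comp wactM wactV !mulgA mulgK.
Qed.

Lemma depthM j g h : depth j g -> depth j h -> depth j (g * h).
Proof.
move=> Dg Dh i w Vw; rewrite wactD_mul.
apply: wlcM; first by apply: wlcM; [apply: Dg | apply: Dh].
by rewrite addnC in Dg Dh *; apply: wlc_leq (Dg _ _ (Dh _ _ Vw)); lia.
Qed.

(* Three-subgroup argument: [gh] and [hg] act in the same way up to depth [j + 1]. *)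
Lemma depth_comm j g h : depth j g -> depth j.+1 [~ g, h].
Proof.
move=> Dg i w Vw; set r := (wact (h * g) w)^-1 * wact (g * h) w.
have -> : wactD [~ g, h] w = wact (h * g)^-1 r.
  rewrite /r wactM wactV !wact_comp mulVg wact_one commgEl conjgE invMg.
  by rewrite !mulgA.
apply: wlc_wact.
have -> : r = (wactD h w * wactD g w * wactD h (wactD g w))^-1 *
              (wactD g w * wactD h w * wactD g (wactD h w)).
  by rewrite -!wactD_mul /r /wactD invMg invgK !mulgA mulgK.
have Vg := Dg _ _ Vw; have Vh := wlc_wactD1 h Vw.
have := wlc_wactD1 h Vg; have := Dg _ _ Vh; rewrite addnS addSn.
move: (wactD g w) (wactD h w) (wactD h (wactD g w)) (wactD g (wactD h w)) Vg Vh.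
move=> a b c d Va Vb Vd Vc.
have -> : (b * a * c)^-1 * (a * b * d) = c^-1 * [~ a, b] * d.
  by rewrite commgEl conjgE !invMg !mulgA.
by apply: wlcM => //; apply: wlcM; [apply: wlcV | apply: wlc_comm1].
Qed.

Lemma depth_lcn j g : g \in L j -> depth j g.
Proof.
elim: j g => [|[|j] IHj] g Lg.
  move=> i w Vw; rewrite addn0.
  by apply: wlcM; [apply: wlcV | apply: wlc_wact].
  by move=> i w Vw; rewrite addn1; apply: wlc_wactD1.
(* The elements of depth [j.+2] form a group, so it suffices to treat the commutators that generate
   [L j.+2]. *)
have Gset : group_set [set x | `[< depth j.+2 x >]].
  apply/group_setP; split=> [|x y]; rewrite !inE.
    by apply/asboolP => i w _; rewrite /wactD wact_one mulVg; apply: wlc1.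
  by move=> /asboolP Dx /asboolP Dy; apply/asboolP; apply: depthM.
suffices /subsetP/(_ g Lg) : L j.+2 \subset group Gset by rewrite inE => /asboolP.
rewrite lcnSn gen_subG; apply/subsetP => _ /imset2P[x y Lx _ ->].
by rewrite inE; apply/asboolP/depth_comm/IHj.
Qed.

Lemma wlc_wactD i j g w : g \in L j -> wlc i w -> wlc (i + j) (wactD g w).
Proof. by move/depth_lcn; apply. Qed.

Lemma wlc_comm i j w z : wlc i w -> wlc j z -> wlc (i + j) [~ w, z].
Proof.
move=> Vw Vz; rewrite -[z]invgK -wactD_bd; apply: wlc_wactD Vw.
by apply: wlc_bd; apply: wlcV.
Qed.

End WedgeFiltration.

(** * Monomials in commuting elements, given by exponent vectors *)

Section Monomials.

Variable W : groupType.
Implicit Types (x y : W) (s : seq W) (e f : seq nat).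

Fixpoint mono s e : W :=
  if (s, e) is (x :: s', a :: e') then x ^+ a * mono s' e' else 1.

Lemma commute_mono s e x : {in s, forall y, commute x y} -> commute x (mono s e).
Proof.
elim: s e => [|y s IHs] [|a e] cs /=; do ?exact: commute1.
apply: commuteM; first by apply/commuteX/cs/mem_head.
by apply: IHs => z sz; apply: cs; rewrite inE sz orbT.
Qed.

Lemma monoM s e f : {in s &, forall x y, commute x y} -> size e = size f ->
  mono s e * mono s f = mono s [seq a.1 + a.2 | a <- zip e f].
Proof.
elim: s e f => [|x s IHs] [|a e] [|b f] //= cs; rewrite ?mulg1 // => -[sz].
rewrite expgnDr -!mulgA -IHs //; last first.
  by move=> y z sy sz'; apply: cs; rewrite inE ?sy ?sz' orbT.
congr (_ * _); rewrite !mulgA; congr (_ * _).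
apply/commute_sym/commute_mono => y sy; apply/commute_sym/commuteX/commute_sym.
by apply: cs; rewrite inE ?sy ?eqxx ?orbT.
Qed.

Lemma mono_exp1 n s e : all (dvdn n) e -> {in s, forall x, x ^+ n = 1} -> mono s e = 1.
Proof.
elim: s e => [|x s IHs] [|a e] //= /andP[/dvdnP[b ->] dv] sn.
rewrite IHs //; last by move=> y sy; apply: sn; rewrite inE sy orbT.
by rewrite mulg1 mulnC expgnA sn ?mem_head // expg1n.
Qed.

End Monomials.

(** * Collection of twisted powers *)

Section TwistedPowers.

Variables (W : groupType) (phi : W -> W) (w : W).
Hypothesis phiM : {morph phi : x y / x * y}.

(** The product w phi(w) ... phi^(k-1)(w), a norm for [phi]. *)
Fixpoint twpow k : W := if k is k'.+1 then w * phi (twpow k') else 1.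

Lemma twpowSr k : twpow k.+1 = twpow k * iter k phi w.
Proof.
have phi1 : phi 1 = 1 by apply: (mulgI (phi 1)); rewrite -phiM !mulg1.
elim: k => [|k IHk]; first by rewrite /= phi1 mulg1 mul1g.
have -> : twpow k.+2 = w * phi (twpow k.+1) by [].
by rewrite [in LHS]IHk phiM mulgA.
Qed.

Variables d1 d2 d3 d4 : W.
Hypotheses (phi_w : phi w = w * d1) (phi_d1 : phi d1 = d1 * d2).
Hypotheses (phi_d2 : phi d2 = d2 * d3) (phi_d3 : phi d3 = d3 * d4) (phi_d4 : phi d4 = d4).

Let s := [:: d1; d2; d3; d4; [~ d1, w]; [~ d2, w]].
Hypothesis sC : {in s &, forall x y : W, commute x y}.
Hypotheses (wC3 : commute d3 w) (wC4 : commute d4 w).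
Hypotheses (wC5 : commute [~ d1, w] w) (wC6 : commute [~ d2, w] w).

(** Expand (1 + (phi - 1))^k by Pascal's rule; the two commutator slots stay at 0 until [w] is
    moved. *)
Lemma iter_twist k :
  iter k phi w = w * mono s [:: k; 'C(k, 2); 'C(k, 3); 'C(k, 4); 0; 0].
Proof.
have phiX x n : phi (x ^+ n) = phi x ^+ n.
  elim: n => [|n IHn]; last by rewrite !expgS phiM IHn.
  by apply: (mulgI (phi x)); rewrite -phiM expg0 !mulg1.
elim: k => [|k IHk]; first by rewrite /= !mulg1.
rewrite iterS IHk /= !mulg1 !phiM !phiX phi_w phi_d1 phi_d2 phi_d3 phi_d4.
rewrite !expgMn; try by apply: sC; rewrite !inE eqxx ?orbT.
rewrite !binS !bin1 [('C(k, 2) + k)%N]addnC.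
rewrite [('C(k, 3) + _)%N]addnC [('C(k, 4) + _)%N]addnC.
by rewrite expgS !expgnDr !mulgA.
Qed.

(** Only [d1] and [d2] need not commute with [w]; each passage of [w] adds their exponents to those
    of the two commutators. *)
Lemma mono_mulr a b c d p q :
  mono s [:: a; b; c; d; p; q] * w = w * mono s [:: a; b; c; d; p + a; q + b]%N.
Proof.
have E1 : d1 ^+ a * w = w * mono s [:: a; 0; 0; 0; a; 0]%N.
  rewrite (conjgC (d1 ^+ a)) conjXg.
  have -> : d1 ^ w = d1 * [~ d1, w] by rewrite commgEl mulKVg.
  by rewrite expgMn /= ?mulg1 ?mul1g //; apply: sC; rewrite !inE eqxx ?orbT.
have E2 : d2 ^+ b * w = w * mono s [:: 0; b; 0; 0; 0; b]%N.
  rewrite (conjgC (d2 ^+ b)) conjXg.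
  have -> : d2 ^ w = d2 * [~ d2, w] by rewrite commgEl mulKVg.
  by rewrite expgMn /= ?mulg1 ?mul1g //; apply: sC; rewrite !inE eqxx ?orbT.
have E3 : mono s [:: 0; 0; c; d; p; q]%N * w = w * mono s [:: 0; 0; c; d; p; q]%N.
  rewrite /= !mul1g mulg1; apply: commute_sym.
  by do !(apply: commuteM); apply: commuteX; apply: commute_sym.
have -> : mono s [:: a; b; c; d; p; q] =
    d1 ^+ a * (d2 ^+ b * mono s [:: 0; 0; c; d; p; q]%N).
  by rewrite /= !mul1g.
rewrite -(mulgA (d1 ^+ a)) -(mulgA (d2 ^+ b)) E3 (mulgA (d2 ^+ b)) E2.
rewrite -(mulgA w) (mulgA (d1 ^+ a)) E1 -(mulgA w) !monoM //=.
by rewrite !addn0 !add0n [(a + p)%N]addnC [(b + q)%N]addnC.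
Qed.

(** Every exponent grows by Pascal's rule. The commutators gain the current exponents ['C(k, 2)] and
    ['C(k, 3)] of [d1] and [d2] when [w] passes, hence end one binomial further. *)
Lemma twpow_collect k : twpow k =
  w ^+ k * mono s [:: 'C(k, 2); 'C(k, 3); 'C(k, 4); 'C(k, 5); 'C(k, 3); 'C(k, 4)].
Proof.
elim: k => [|k IHk]; first by rewrite /= !mulg1.
rewrite twpowSr IHk iter_twist mulgA -(mulgA (w ^+ k)) mono_mulr.
rewrite (mulgA (w ^+ k)) -expgSr -(mulgA (w ^+ k.+1)) monoM //=.
by rewrite !binS !bin1 !addn0.
Qed.

End TwistedPowers.

(** * Powers in G /\ G as twisted powers *)

Section PowerProducts.

Variable gT : finGroupType.
Implicit Types (g h x y : gT) (w z : wedge gT) (i j k : nat).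

Lemma wg_expg x y k : wg x (y ^+ k) = twpow (wact y) (wg x y) k.
Proof. by elim: k => [|k IHk]; rewrite ?expg0 ?wg1 // expgS wgMr IHk. Qed.

(** Move all factors [z] to the right; each passage conjugates by [z], which is the action of
    [bd z]. *)
Lemma expgM_twpow w z k : (w * z) ^+ k = twpow (wact (bd z)) w k * z ^+ k.
Proof.
elim: k => [|k IHk]; first by rewrite mulg1.
by rewrite expgS IHk /= wact_bd (expgS z) !mulgA mulgKV.
Qed.

End PowerProducts.

Lemma dvdn_bin n m : coprime n m.+1 -> n %| 'C(n, m.+1).
Proof. by move=> co; rewrite -(Gauss_dvdr _ co) -mul_bin_diag dvdn_mulr. Qed.

(** * Weights and exponents in class five *)

Section ClassFive.

Variable gT : finGroupType.
Implicit Types (g h x y : gT) (w z : wedge gT) (i j k : nat).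

Hypothesis class5 : 'L_6([set: gT]) = 1.

Lemma wlc7 w : wlc 7 w -> w = 1.
Proof.
elim=> {w} [|w z _ -> _ ->|w _ ->|g h] //; rewrite ?mulg1 ?invg1 //.
by rewrite class5 => /set1P ->; rewrite wg1.
Qed.

Lemma wlc_commute i j w z : wlc i w -> wlc j z -> 6 < i + j -> commute w z.
Proof.
move=> Vw Vz ij; apply/commgP/eqP/wlc7.
exact: wlc_leq ij (wlc_comm Vw Vz).
Qed.

Lemma wlc_commuteT i w z : wlc i w -> 4 < i -> commute w z.
Proof. by move=> Vw lt_i; apply: (wlc_commute Vw (wlc2 z)); lia. Qed.

Variable n : nat.
Hypotheses (exp_n : forall g, g ^+ n = 1) (co2 : coprime n 2) (co3 : coprime n 3).

(** Since [n] is prime to 2 and 3, it divides all collected exponents except possibly ['C(n, 5)],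
    which may lose a factor 5; so the fourth difference survives. *)
Lemma twpow_wact_expn i g w : (forall z, wlc i.+1 z -> z ^+ n = 1) -> 1 < i -> wlc i w ->
  twpow (wact g) w n = w ^+ n * iter 4 (wactD g) w ^+ 'C(n, 5).
Proof.
move=> exp_i lt_i Vi.
have V1 := wlc_wactD1 g Vi; have V2 := wlc_wactD1 g V1.
have V3 := wlc_wactD1 g V2; have V4 := wlc_wactD1 g V3.
have V5 := wlc_wactD1 g V4.
have W1 := wlc_comm V1 (wlc2 w); have W2 := wlc_comm V2 (wlc2 w).
have eq1 (d : wedge gT) : wlc i.+1 d -> forall m, n %| m -> d ^+ m = 1.
  by move=> Vd m /dvdnP[q ->]; rewrite mulnC expgnA  exp_i // expg1n.
rewrite [in RHS]/=; set d1 := wactD g w in V1 V2 V3 V4 V5 W1 W2 *.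
set d2 := wactD g d1 in V2 V3 V4 V5 W1 W2 *.
set d3 := wactD g d2 in V3 V4 V5 W1 W2 *.
set d4 := wactD g d3 in V4 V5 W1 W2 *.
have Z (d : wedge gT) j : wlc j d -> 4 < j -> forall z, commute d z.
  by move=> Vd lt_j z; apply: wlc_commuteT Vd _.
(* As i >= 2, [d1] and [d2] have weights at least 3 and 4, which add up to 7; [d3], [d4] and both
   commutators have weight at least 5 and are central. *)
have C12 : commute d1 d2 by apply: wlc_commute V1 V2 _; lia.
have Z3 := Z _ _ V3 (ltac:(lia)); have Z4 := Z _ _ V4 (ltac:(lia)).
have Z5 := Z _ _ W1 (ltac:(lia)); have Z6 := Z _ _ W2 (ltac:(lia)).
have le j z : i < j -> wlc j z -> wlc i.+1 z by apply: wlc_leq.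
have [/eq1 x1 /eq1 x2 /eq1 x3] : [/\ wlc i.+1 d1, wlc i.+1 d2 & wlc i.+1 d3].
  by split=> //; [apply: le V2 | apply: le V3]; lia.
have [/eq1 x5 /eq1 x6] : wlc i.+1 [~ d1, w] /\ wlc i.+1 [~ d2, w].
  by split; [apply: le W1 | apply: le W2]; lia.
have [dv2 dv3 dv4] : [/\ n %| 'C(n, 2), n %| 'C(n, 3) & n %| 'C(n, 4)].
  by split; apply: dvdn_bin => //; rewrite (@coprimeMr _ 2 2) co2.
(* The fifth difference has weight at least 7. *)
have d4_fix : wact g d4 = d4 by rewrite wact_wactD (wlc7 (wlc_leq _ V5)) ?mulg1 //; lia.
rewrite (@twpow_collect _ (wact g) w (wactM g) d1 d2 d3 d4) //; try exact: wact_wactD.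
- by rewrite /= x1 // x2 // x3 // x5 // x6 // !mulg1 !mul1g.
- have Zs z : z \in [:: d3; d4; [~ d1, w]; [~ d2, w]] -> forall t, commute z t.
    by rewrite !inE => /or4P[] /eqP ->.
  move=> x y; rewrite inE => /predU1P[->|]; last rewrite inE => /predU1P[->|/Zs] //.
    rewrite inE => /predU1P[->|]; first exact: commute_refl.
    by rewrite inE => /predU1P[-> //|/Zs Zy]; apply/commute_sym.
  rewrite inE => /predU1P[->|]; first exact/commute_sym.
  by rewrite inE => /predU1P[->|/Zs Zy]; [apply: commute_refl | apply/commute_sym].
Qed.

(** For i >= 3 the elements that act lie in L_2 or deeper, so the fourth difference has weight at
    least 3 + 4 * 2 = 11 and is trivial. *)
Lemma wlc_expn i w : 2 < i -> wlc i w -> w ^+ n = 1.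
Proof.
move: {2}(7 - i)%N (leqnn (7 - i)) => m; elim: m i w => [|m IHm] i w le_m lt_i Vw.
  by rewrite (wlc7 (wlc_leq _ Vw)) ?expg1n //; lia.
have exp_i z : wlc i.+1 z -> z ^+ n = 1 by apply: IHm; lia.
elim: Vw => {w} [|w z Vw wn Vz zn|w Vw wn|g h Lh].
- exact: expg1n.
- rewrite expgM_twpow (twpow_wact_expn _ exp_i) ?(ltnW lt_i) // wn zn mulg1 mul1g.
  have := wlc_bd Vz; move: (bd z) => g Lg.
  have V4 : wlc (i + i + i + i + i) (iter 4 (wactD g) w) by do 4!apply: wlc_wactD => //.
  by rewrite (wlc7 (wlc_leq _ V4)) ?expg1n //; lia.
- by rewrite expVgn wn invg1.
- have := wg_expg g h n; rewrite exp_n wg1.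
  have Vw := wlc_gen g Lh; rewrite (twpow_wact_expn _ exp_i) ?(ltnW lt_i) //.
  have V4 : wlc (i + i.-1 + i.-1 + i.-1 + i.-1) (iter 4 (wactD h) (wg g h)).
    by do 4!apply: wlc_wactD => //.
  by rewrite (wlc7 (wlc_leq _ V4)) ?expg1n ?mulg1 //; lia.
Qed.

End ClassFive.

(** * Calculus modulo the filtration, and polynomial dependence on an exponent *)

Section Congruence.

Variable gT : finGroupType.
Implicit Types (g h x y : gT) (u v w z : wedge gT).
Implicit Types (i j k d m : nat) (c : nat -> wedge gT).

Definition wcong k w z := wlc k (w^-1 * z).

Lemma wcong_refl k w : wcong k w w.
Proof. by rewrite /wcong mulVg; apply: wlc1. Qed.

Lemma wcong_sym k w z : wcong k w z -> wcong k z w.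
Proof. by move=> /wlcV; rewrite invMg invgK. Qed.

Lemma wcong_trans k z w u : wcong k w z -> wcong k z u -> wcong k w u.
Proof. by move=> wz zu; have := wlcM wz zu; rewrite !mulgA mulgK. Qed.

Lemma wcongM k w w' z z' : wcong k w w' -> wcong k z z' -> wcong k (w * z) (w' * z').
Proof.
move=> ww' zz'; have := wlcM (wlc_conj z^-1 ww') zz'.
by rewrite /wcong invgK invMg !mulgA mulgK.
Qed.

Lemma wcongX k w z m : wcong k w z -> wcong k (w ^+ m) (z ^+ m).
Proof.
by move=> wz; elim: m => [|m IHm]; rewrite ?expgS; [apply: wcong_refl | apply: wcongM].
Qed.

Lemma wcongC i w z : wlc i w -> wcong i.+1 (z * w) (w * z).
Proof.
move=> Vw; have -> : wcong i.+1 (z * w) (w * z) = wlc i.+1 [~ w, z].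
  by rewrite /wcong invMg commgEl conjgE !mulgA.
exact: wlc_comm1.
Qed.

Lemma wcongMn i w z m : wlc i w -> wcong i.+1 ((w * z) ^+ m) (w ^+ m * z ^+ m).
Proof.
move=> Vw; elim: m => [|m IHm]; first by rewrite !expg0 mulg1; apply: wcong_refl.
rewrite 3!expgS; apply: (wcong_trans (wcongM (wcong_refl _ _) IHm)).
rewrite -!mulgA; apply: wcongM (wcong_refl _ _) _; rewrite !mulgA.
by apply: wcongM (wcong_refl _ _); apply/wcongC/wlcX.
Qed.

Lemma wactD1 g : wactD g 1 = 1.
Proof. by rewrite /wactD wact1g mulVg. Qed.

(** The error is the commutator of [wactD g u] and [v], of weight 2i + 1 >= i + 2. *)
Lemma wactDM_cong i g u v : 0 < i -> wlc i u -> wlc i v ->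
  wcong i.+2 (wactD g (u * v)) (wactD g u * wactD g v).
Proof.
move=> lt_i Vu Vv; apply: wcong_sym.
have -> : wactD g (u * v) = wactD g u ^ v * wactD g v.
  by rewrite /wactD conjgE wactM invMg !mulgA mulgK.
apply: wcongM (wcong_refl _ _); rewrite /wcong -commgEl.
by apply: wlc_leq (wlc_comm (wlc_wactD1 g Vu) Vv); lia.
Qed.

Lemma wactD_cong i g w z : 0 < i -> wlc i w -> wcong i.+1 w z ->
  wcong i.+2 (wactD g w) (wactD g z).
Proof.
move=> lt_i Vw wz; have -> : z = w * (w^-1 * z) by rewrite mulVKg.
apply: wcong_sym; apply: wcong_trans (wactDM_cong g lt_i Vw (wlcS wz)) _.
apply: wcong_sym; rewrite /wcong mulgA mulVg mul1g.
exact: wlc_wactD1.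
Qed.

Lemma wactDX_cong i g w m : 0 < i -> wlc i w ->
  wcong i.+2 (wactD g (w ^+ m)) (wactD g w ^+ m).
Proof.
move=> lt_i Vw; elim: m => [|m IHm]; first by rewrite !expg0 wactD1; apply: wcong_refl.
rewrite !expgS; apply: wcong_trans (wactDM_cong _ lt_i Vw (wlcX _ Vw)) _.
exact: wcongM (wcong_refl _ _) IHm.
Qed.

Lemma wactD_mul_cong i g h w : wlc i w ->
  wcong i.+2 (wactD (g * h) w) (wactD g w * wactD h w).
Proof.
move=> Vw; apply: wcong_sym; rewrite wactD_mul /wcong mulgA mulVg mul1g.
by do 2!apply: wlc_wactD1.
Qed.

Lemma wactD_exp_cong i g w m : wlc i w ->
  wcong i.+2 (wactD (g ^+ m) w) (wactD g w ^+ m).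
Proof.
move=> Vw; elim: m => [|m IHm].
  by rewrite !expg0 /wactD wact_one mulVg; apply: wcong_refl.
rewrite !expgS; apply: wcong_trans (wactD_mul_cong _ _ Vw) _.
exact: wcongM (wcong_refl _ _) IHm.
Qed.

(** A polynomial in [k], written multiplicatively; [d] counts the terms, so the degree is below
    [d]. *)
Fixpoint wpoly c d k := if d is d'.+1 then wpoly c d' k * c d' ^+ (k ^ d')%N else 1.

(** Multiplication of a polynomial by its variable. *)
Definition wshift c j := if j is j'.+1 then c j' else 1.

Lemma wlc_wpoly i c d k : (forall j, wlc i (c j)) -> wlc i (wpoly c d k).
Proof.
by move=> Vc; elim: d => [|d IHd] /=; [apply: wlc1 | apply: wlcM => //; apply: wlcX].
Qed.

Lemma wpolyM_cong i b c d k : (forall j, wlc i (b j)) -> (forall j, wlc i (c j)) ->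
  wcong i.+1 (wpoly b d k * wpoly c d k) (wpoly (fun j => b j * c j) d k).
Proof.
move=> Vb Vc; elim: d => [|d IHd] /=; first by rewrite mulg1; apply: wcong_refl.
set m := (k ^ d)%N.
apply: (@wcong_trans _ (wpoly b d k * wpoly c d k * (b d ^+ m * c d ^+ m))).
  rewrite -!mulgA; apply: wcongM (wcong_refl _ _) _; rewrite !mulgA.
  by apply: wcongM (wcong_refl _ _); apply/wcongC/wlc_wpoly.
by apply: wcongM => //; apply/wcong_sym/wcongMn.
Qed.

Lemma wpolyX_cong i c d k : (forall j, wlc i (c j)) ->
  wcong i.+1 (wpoly c d k ^+ k) (wpoly (wshift c) d.+1 k).
Proof.
move=> Vc; elim: d => [|d IHd]; first by rewrite /= !expg1n mulg1; apply: wcong_refl.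
rewrite [wpoly _ d.+2 k]/= -/(wpoly (wshift c) d.+1 k) [wpoly c _ _]/=.
apply: wcong_trans (wcongMn _ _ (wlc_wpoly _ _ Vc)) _.
by apply: wcongM => //; rewrite -expgnA -expnSr; apply: wcong_refl.
Qed.

Lemma wactD_wpoly_cong i g c d k : 0 < i -> (forall j, wlc i (c j)) ->
  wcong i.+2 (wactD g (wpoly c d k)) (wpoly (fun j => wactD g (c j)) d k).
Proof.
move=> lt_i Vc; elim: d => [|d IHd] /=; first by rewrite wactD1; apply: wcong_refl.
apply: wcong_trans (wactDM_cong _ lt_i (wlc_wpoly _ _ Vc) (wlcX _ (Vc d))) _.
exact: wcongM IHd (wactDX_cong _ _ lt_i (Vc d)).
Qed.

(** Here [d] bounds the degree and [l] is the coefficient there. Elements of weight [i] commute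
    modulo weight [i.+1], so products behave as sums; the values 1 past [d] allow reading the
    polynomial with more terms. *)
Definition wpolynomial i d l (f : nat -> wedge gT) := exists c,
  [/\ forall j, wlc i (c j), c d = l, forall j, d < j -> c j = 1
    & forall k, wcong i.+1 (f k) (wpoly c d.+1 k)].

(** Modulo weight [i.+2] the difference operator of y x^k is D_y + k D_x, so the coefficient of k^j
    becomes D_y c_j + D_x c_(j-1). *)
Lemma wpolynomial_wactD i d l f x y : 0 < i -> (forall k, wlc i (f k)) ->
  wpolynomial i d l f ->
  wpolynomial i.+1 d.+1 (wactD x l) (fun k => wactD (y * x ^+ k) (f k)).
Proof.
move=> lt_i Vf [c [Vc cd c1 fc]]; pose cy j := wactD y (c j); pose cx j := wactD x (c j).
have Vcy j : wlc i.+1 (cy j) by apply: wlc_wactD1.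
have Vcx j : wlc i.+1 (cx j) by apply: wlc_wactD1.
have Vsx j : wlc i.+1 (wshift cx j) by case: j => //; apply: wlc1.
exists (fun j => cy j * wshift cx j); split=> [j||[|j] lt_dj|k]; first exact: wlcM.
- by rewrite /cy c1 // wactD1 mul1g /= /cx cd.
- by [].
- by rewrite /cy /= /cx !c1 ?wactD1 ?mulg1 // ltnW.
set Q := wpoly c d.+1 k; have VQ : wlc i Q by apply: wlc_wpoly.
apply: (wcong_trans (wactD_cong _ lt_i (Vf k) (fc k))).
apply: (wcong_trans (wactD_mul_cong _ _ VQ)).
apply: wcong_trans (wpolyM_cong _ _ Vcy Vsx); apply: wcongM.
  have -> : wpoly cy d.+2 k = wpoly cy d.+1 k.
    by rewrite [LHS]/= -/(wpoly cy d.+1 k) /cy c1 // wactD1 expg1n mulg1.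
  exact: wactD_wpoly_cong.
apply: (wcong_trans (wactD_exp_cong _ _ VQ)).
apply: wcong_trans (wpolyX_cong _ _ Vcx).
by apply: wcongX; apply: wactD_wpoly_cong.
Qed.

(** Start from the constant [w], of degree 0 and weight 2; each difference raises both by one. *)
Lemma wpolynomial_iter_wactD p w x y :
  wpolynomial p.+2 p (iter p (wactD x) w) (fun k => iter p (wactD (y * x ^+ k)) w).
Proof.
elim: p => [|p IHp].
  exists (fun j => if j is 0 then w else 1); split=> // [j||k].
  - exact: wlc2.
  - by case.
  - by rewrite /= mul1g; apply: wcong_refl.
apply: wpolynomial_wactD IHp => // k.
by elim: p => [|p IHp] /=; [apply: wlc2 | apply: wlc_wactD1].
Qed.

Lemma wlc_iter_wactD p g w : wlc p.+2 (iter p (wactD g) w).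
Proof. by elim: p => [|p IHp]; [apply: wlc2 | apply: wlc_wactD1]. Qed.

Lemma iter_wactDM_cong p g w z :
  wcong p.+3 (iter p (wactD g) (w * z)) (iter p (wactD g) w * iter p (wactD g) z).
Proof.
elim: p => [|p IHp]; first exact: wcong_refl.
apply: wcong_trans (wactD_cong g _ (wlc_iter_wactD _ _ _) IHp) _ => //.
by apply: wactDM_cong => //; apply: wlc_iter_wactD.
Qed.

End Congruence.

(** * The exponent of G /\ G in class five *)

Section ClassFiveExponent.

Variable gT : finGroupType.
Implicit Types (g h x y : gT) (w z : wedge gT).

Hypothesis class5 : 'L_6([set: gT]) = 1.

Variable n : nat.
Hypotheses (exp_n : forall g, g ^+ n = 1) (co2 : coprime n 2) (co3 : coprime n 3).

Lemma wg_expn_wactD x y : wg x y ^+ n * iter 4 (wactD y) (wg x y) ^+ 'C(n, 5) = 1.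
Proof.
rewrite -(twpow_wact_expn class5 co2 co3 (i := 2)) //; first last.
- exact: wlc2.
- by move=> z; apply: (wlc_expn class5 exp_n).
by rewrite -wg_expg exp_n wg1.
Qed.

Lemma wg_mulr_expg x y k : wg x (y * x ^+ k) = wg x y.
Proof.
rewrite wgMr; suffices -> : wg x (x ^+ k) = 1 by rewrite wact1g mulg1.
by elim: k => [|k IHk]; rewrite ?expg0 ?wg1 // expgS wgMr wgg IHk wact1g mulg1.
Qed.

(** The product of the equal values at k = 0, ..., 4 isolates the leading coefficient: the sum of
    k^j over these k is 0 modulo 5 for j < 4 and -1 for j = 4. *)
Lemma iter_wactD_expn x y : iter 4 (wactD x) (wg x y) ^+ 'C(n, 5) = 1.
Proof.
set w := wg x y; set M := 'C(n, 5).
(* The weight is 6: the coefficients are central, and a congruence modulo weight 7 is an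
   equality. *)
have [c [Vc <- c1 Tc]] := wpolynomial_iter_wactD 4 w x y.
have cC j z : commute (c j) z by apply: wlc_commuteT (Vc j) _.
(* Use 5 C(n, 5) = n C(n-1, 4); weight 6 has exponent dividing [n]. *)
have c5 j : (c j ^+ M) ^+ 5 = 1.
  rewrite -expgnA mulnC -mul_bin_diag expgnA.
  by rewrite (wlc_expn class5 exp_n co2 co3 _ (Vc j)) // expg1n.
pose s := [:: c 0 ^+ M; c 1 ^+ M; c 2 ^+ M; c 3 ^+ M; c 4 ^+ M]%N.
have sC : {in s &, forall z t : wedge gT, commute z t}.
  move=> z t; rewrite !inE => z_s _.
  have [j ->] : exists j, z = c j ^+ M.
    by case/or4P: z_s => [||| /orP[]] /eqP ->; eexists.
  exact/commute_sym/commuteX/commute_sym.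
have s5 : {in s, forall z : wedge gT, z ^+ 5 = 1}.
  by move=> z; rewrite !inE => /or4P[||| /orP[]] /eqP ->.
(* Since x /\ y x^k = [w] for all [k], the first factor does not depend on [k]. *)
have E k : w ^+ n * mono s [:: k ^ 0; k ^ 1; k ^ 2; k ^ 3; k ^ 4]%N = 1.
  have <- : wpoly c 5 k ^+ M = mono s [:: k ^ 0; k ^ 1; k ^ 2; k ^ 3; k ^ 4]%N.
    rewrite /= mul1g mulg1; do 4!
      (rewrite expgMn; last by apply/commuteX/commute_sym/cC).
    by rewrite -!mulgA !(expgnAC _ M).
  have := wg_expn_wactD x (y * x ^+ k); rewrite wg_mulr_expg -/w => <-.
  congr (_ * _ ^+ _); apply/esym/(mulgI (iter 4 (wactD (y * x ^+ k)) w)^-1).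
  by rewrite mulVg [RHS](wlc7 class5 (Tc k)).
(* At k = 0 only the constant term is left, with 0^0 = 1. *)
have Econst k : mono s [:: k ^ 0; k ^ 1; k ^ 2; k ^ 3; k ^ 4]%N = c 0%N ^+ M.
  apply: (mulgI (w ^+ n)); rewrite E -(E 0%N); congr (_ * _).
  by rewrite /= !mulg1.
(* [0^j + 1^j + 2^j + 3^j + 4^j = 5, 10, 30, 100, 354] for [j = 0, ..., 4]. *)
have : mono s [:: 5; 10; 30; 100; 354]%N = 1.
  rewrite -(c5 0%N) !expgS expg0 mulg1.
  rewrite -{1}(Econst 0%N) -{1}(Econst 1%N) -{1}(Econst 2) -{1}(Econst 3) -(Econst 4).
  by rewrite !monoM.
have c4 : c 4 ^+ M = mono s [:: 0; 0; 0; 0; 1]%N by rewrite /= !mul1g mulg1.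
(* One more factor [c 4 ^+ M] raises 354 to 355, and then all exponents are multiples of 5. *)
move=> E1; rewrite c4 -[RHS](mono_exp1 (n := 5) (e := [:: 5; 10; 30; 100; 355]%N) _ s5) //.
by rewrite -[LHS]mul1g -E1 monoM.
Qed.

(** Fourth differences are multiplicative modulo weight 7, so those of y /\ x and x /\ y are
    inverse, and [iter_wactD_expn] applies with x and y exchanged. *)
Lemma wg_expn x y : wg x y ^+ n = 1.
Proof.
have /mulg1_eq iterV : iter 4 (wactD y) (wg y x) * iter 4 (wactD y) (wg x y) = 1.
  have := wlc7 class5 (iter_wactDM_cong 4 y (wg y x) (wg x y)).
  rewrite (wgV y x) mulVg -(wgV y x); have -> : iter 4 (wactD y) 1 = 1 by rewrite /= !wactD1.
  by rewrite invg1 mul1g.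
have := wg_expn_wactD x y.
by rewrite -iterV expVgn iter_wactD_expn invg1 mulg1.
Qed.

Lemma wedge_expn w : w ^+ n = 1.
Proof.
have expM z t : z ^+ n = 1 -> t ^+ n = 1 -> (z * t) ^+ n = 1.
  move=> zn tn; rewrite expgM_twpow tn mulg1.
  rewrite (twpow_wact_expn class5 co2 co3 (i := 2)) ?zn //; last exact: wlc2.
    (* As [bd t] lies in L_2, the fourth difference has weight at least 2 + 4 * 2 = 10. *)
    have : bd t \in 'L_2([set: gT]) by apply/wlc_bd/wlc2.
    move: (bd t) => g Lg; have V10 : wlc (2 + 2 + 2 + 2 + 2) (iter 4 (wactD g) z).
      by do 4!apply: wlc_wactD => //; apply: wlc2.
    by rewrite (wlc7 class5 (wlc_leq _ V10)) // expg1n mulg1.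
  by move=> u; apply: (wlc_expn class5 exp_n).
elim/wedge_ind: w => [|g h w IH|g h w IH]; first exact: expg1n.
  by apply: expM => //; apply: wg_expn.
by apply: expM => //; rewrite expVgn wg_expn invg1.
Qed.

End ClassFiveExponent.

(** * Application to 5-groups of class five *)

Theorem theorem3p14 (gT : finGroupType) :
  (5.-group [set: gT])%g ->
  nilpotent [set: gT] ->
  nil_class [set: gT] = 5 ->
  wedge_exp_dvd gT (exponent [set: gT]).
Proof.
move=> pG nilG clG w; apply/wclsP; rewrite wcls_wpow.
have co m : prime m -> m != 5 -> coprime (exponent [set: gT]) m.
  by move=> pr_m ne5; apply: (@pnat_coprime 5); rewrite ?pnat_exponent ?pnatE.
apply: wedge_expn; [|by move=> g; apply: expg_exponent; rewrite inE|exact: co|exact: co].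
by apply/(lcn_nil_classP 5 nilG); rewrite clG.
Qed.
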